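(* Let $f:\omega\to\omega$ be a computable, nondecreasing, unbounded function. If $A \subseteq \omega$ is a $\Delta^0_2$ set that has an asymptotic density, then there is an $f$-c.e. set $B$ that has an asymptotic density, with $\rho(B)=\rho(A)$.
   Context: For $X \subseteq \omega=\{0,1,2,\dots\}$ and an integer $m>0$, let $\rho_m(X) = |\{j \in X : j < m\}|/m$. The set $X$ has a (asymptotic) density if $\lim_m \rho_m(X)$ exists, and the density is then $\rho(X) = \lim_m \rho_m(X)$. Sets are identified with their characteristic functions. For a function $f:\omega\to\omega$, a set $A \subseteq \omega$ is $f$-c.e. if there is a computable function $g:\omega\times\omega\to\{0,1\}$ such that for all $x$: $g(x,0)=0$, $A(x)=\lim_s g(x,s)$, and $|\{s : g(x,s) \neq g(x,s+1)\}| \leq f(x)$. *)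

(* Defs.v *)
From HB Require Import structures.
From mathcomp Require Import all_boot all_order all_algebra.
From mathcomp Require Import all_classical all_reals all_analysis.

Set Implicit Arguments.
Unset Strict Implicit.
Unset Printing Implicit Defensive.

Import Order.TTheory GRing.Theory Num.Theory.
Import numFieldNormedType.Exports.

Local Open Scope classical_set_scope.
Local Open Scope nat_scope.

(** Kleene's (partial) mu-recursive functions, indexed by arity. *)
Inductive recfun : nat -> Type :=
| RZero : recfun 0
| RSucc : recfun 1
| RProj n (i : 'I_n) : recfun n
| RComp n k (g : recfun k) (h : 'I_k -> recfun n) : recfun n
| RPrec n (g : recfun n) (h : recfun n.+2) : recfun n.+1
| RMu n (g : recfun n.+1) : recfun n.

(** [reval e v y]: the partial function [e] is defined at [v], with value [y].
    In [RPrec], [c] is the course of values: [c 0 = g(w)] and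
    [c (i + 1) = h(i, c i, w)] for the arguments [v = (x, w)].  In [RMu], [g]
    must be defined (and nonzero) below the least zero [y]. *)
Fixpoint reval n (e : recfun n) : n.-tuple nat -> nat -> Prop :=
  match e in recfun n return n.-tuple nat -> nat -> Prop with
  | RZero => fun _ y => y = 0
  | RSucc => fun v y => y = (thead v).+1
  | RProj _ i => fun v y => y = tnth v i
  | RComp _ k g h => fun v y => exists w : k.-tuple nat,
      (forall i, reval (h i) v (tnth w i)) /\ reval g w y
  | RPrec _ g h => fun v y => exists c : nat -> nat,
      [/\ reval g [tuple of behead v] (c 0),
          forall i, i < thead v ->
            reval h [tuple of i :: c i :: behead v] (c i.+1) &
          y = c (thead v)]
  | RMu _ g => fun v y => reval g [tuple of y :: v] 0 /\
      forall z, z < y -> exists u, reval g [tuple of z :: v] u.+1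
  end.

Definition computable1 (f : nat -> nat) : Prop :=
  exists e : recfun 1, forall x, reval e [tuple x] (f x).

Definition computable2 (f : nat -> nat -> nat) : Prop :=
  exists e : recfun 2, forall x y, reval e [tuple x; y] (f x y).

Definition computable3 (f : nat -> nat -> nat -> nat) : Prop :=
  exists e : recfun 3, forall x y z, reval e [tuple x; y; z] (f x y z).

Definition Sigma02 (A : set nat) : Prop :=
  exists P : nat -> nat -> nat -> bool, computable3 P /\
    forall x, A x <-> exists y, forall z, P x y z.

Definition Pi02 (A : set nat) : Prop :=
  exists P : nat -> nat -> nat -> bool, computable3 P /\
    forall x, A x <-> forall y, exists z, P x y z.

Definition Delta02 (A : set nat) : Prop := Sigma02 A /\ Pi02 A.

(** The limit over [s] is taken in the discrete space [bool], and [x \in A] is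
    the value at [x] of the characteristic function of [A]. *)
Definition f_ce (f : nat -> nat) (A : set nat) : Prop :=
  exists g : nat -> nat -> bool,
    computable2 g /\
    forall x, [/\ g x 0 = false,
                  g x s @[s --> \oo] --> (x \in A) &
                  ([set s | g x s != g x s.+1] #<= `I_(f x))%card].

(** [rho R X 0] is the junk value [0 / 0 = 0]. *)
Definition rho (R : realType) (X : set nat) (m : nat) : R :=
  ((\sum_(j < m) (nat_of_ord j \in X))%:R / m%:R)%R.

Definition has_density (R : realType) (X : set nat) : Prop :=
  cvgn (rho R X).

Definition density (R : realType) (X : set nat) : R :=
  limn (rho R X).

(* Main.v *)
From Stdlib Require PeanoNat.
Require Import Defs.
From mathcomp Require Import all_boot all_order all_algebra.
From mathcomp Require Import all_classical all_reals all_analysis.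
From mathcomp Require Import zify lra ring.

(* Let A_s be computable approximations converging to A.  Cut the natural
   numbers into the blocks [K^2, (K+1)^2) and let v(x) be the relative position
   of x in its block.  The values v(x) are uniformly distributed in [0, 1], and
   the sets {x | v(x) < q} increase with q, so if B x <-> v(x) < r(x) outside a
   finite set, where r(x) tends to the density of A, then B has that density.
   At stage s, x guesses r(x) as the proportion of A_s below n, where n is half
   of the number of mind changes that f(x) still allows.  Once A_s has settled
   below n, the value so guessed is constant, and at most one further mind
   change is needed to adopt it, while there are two before n decreases.  As
   only finitely many mind changes occur before A_s settles below n, the final
   n tends to infinity with f(x), and r(x) tends to the density of A. *)

Set Implicit Arguments.
Unset Strict Implicit.
Unset Printing Implicit Defensive.

Import Order.TTheory GRing.Theory Num.Theory.
Import numFieldNormedType.Exports.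

Local Open Scope nat_scope.

(** * Closure properties of the computable functions *)

(* Functions of [n] arguments read their arguments off a list, so that binders
   and projections reduce definitionally. *)
Definition computes n (F : seq nat -> nat) : Prop :=
  exists e : recfun n, forall v : n.-tuple nat, reval e v (F v).

Lemma eq_computes n (F G : seq nat -> nat) :
  (forall v : n.-tuple nat, F v = G v) -> computes n F -> computes n G.
Proof. by move=> FG [e eF]; exists e => v; rewrite -FG. Qed.

Lemma computes_nth n i : i < n -> computes n (fun v => nth 0 v i).
Proof.
by move=> lin; exists (RProj (Ordinal lin)) => v; rewrite /= (tnth_nth 0).
Qed.

Lemma computes_app n k (G : seq nat -> nat) (Fs : k.-tuple (seq nat -> nat)) :
    computes k G -> (forall i, computes n (tnth Fs i)) ->
  computes n (fun v => G [seq F v | F : seq nat -> nat <- Fs]).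
Proof.
move=> [e eG] /fin_all_exists[h hH]; exists (RComp e h) => v /=.
exists [tuple of [seq F v | F : seq nat -> nat <- Fs]].
by split=> [i|]; [rewrite tnth_map | exact: eG].
Qed.

Lemma computes_app1 n (g : nat -> nat) F :
  computable1 g -> computes n F -> computes n (fun v => g (F v)).
Proof.
move=> [e eg] cF.
apply: (@computes_app n 1 (fun w => g (nth 0 w 0)) [tuple F]) => [|i].
  by exists e => w; case/tupleP: w => x w; rewrite (tuple0 w); exact: eg.
by rewrite (tnth_nth F) ord1.
Qed.

Lemma computes_app2 n (g : nat -> nat -> nat) F G :
    computable2 g -> computes n F -> computes n G ->
  computes n (fun v => g (F v) (G v)).
Proof.
move=> [e eg] cF cG.
apply: (@computes_app n 2 (fun w => g (nth 0 w 0) (nth 0 w 1)) [tuple F; G]).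
  exists e => w; case/tupleP: w => x w; case/tupleP: w => y w.
  by rewrite (tuple0 w); exact: eg.
by case=> -[|[|//]].
Qed.

Lemma computes_app3 n (g : nat -> nat -> nat -> nat) F G H :
    computable3 g -> computes n F -> computes n G -> computes n H ->
  computes n (fun v => g (F v) (G v) (H v)).
Proof.
move=> [e eg] cF cG cH.
apply: (@computes_app n 3 (fun w => g (nth 0 w 0) (nth 0 w 1) (nth 0 w 2))
  [tuple F; G; H]).
  exists e => w; case/tupleP: w => x w; case/tupleP: w => y w.
  by case/tupleP: w => z w; rewrite (tuple0 w); exact: eg.
by case=> -[|[|[|//]]].
Qed.

(** Used with [m = 0] to bind a local value, and with [m = 2] to replace the counter and accumulator
    of a recursion by a summation index. *)
Lemma computes_drop m n K F :
    computes (m + n) K -> computes n.+1 F ->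
  computes (m + n) (fun v => F (K v :: drop m v)).
Proof.
move=> cK cF.
pose nths := [tuple (fun v : seq nat => nth 0 v (m + nat_of_ord i)) | i < n].
apply: (@eq_computes _ (fun v => F [seq G v | G : seq nat -> nat <-
    [tuple of K :: nths]])).
  move=> v /=; congr (F (_ :: _)); rewrite -map_comp.
  apply: (@eq_from_nth _ 0) => [|i]; rewrite size_map size_enum_ord.
    by rewrite size_drop size_tuple addKn.
  move=> lti; rewrite (nth_map (Ordinal lti)) ?size_enum_ord //=.
  by rewrite nth_enum_ord // nth_drop.
apply: computes_app => // i; case: (unliftP ord0 i) => [j|] ->.
  by rewrite tnthS tnth_mktuple; apply: computes_nth; rewrite ltn_add2l.
by rewrite tnth0.
Qed.

Lemma computes_let n K F :
  computes n K -> computes n.+1 F -> computes n (fun v => F (K v :: v)).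
Proof.
by move=> cK cF; apply: eq_computes (@computes_drop 0 n K F cK cF) => v;
  rewrite drop0.
Qed.

(** [RPrec] recurses on its first argument, so [K v] is pushed in front of [v], which stays
    available as the parameters. *)
Lemma computes_prec n (G H K : seq nat -> nat) (r : nat -> seq nat -> nat) :
    computes n K -> computes n G -> computes n.+2 H ->
    (forall v, r 0 v = G v) ->
    (forall i v, r i.+1 v = H (i :: r i v :: v)) ->
  computes n (fun v => r (K v) v).
Proof.
move=> cK [g gG] [h hH] r0 rS.
apply: (@computes_let n K (fun w => r (head 0 w) (behead w))) => //.
exists (RPrec g h) => v /=; exists (fun i => r i (behead v)); split.
- by rewrite r0; exact: gG.
- by move=> i _; rewrite rS; exact: hH.
- by case: v => -[].
Qed.

Lemma computes_mu n (F K : seq nat -> nat) :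
    computes n.+1 F -> (forall v, F (K v :: v) = 0) ->
    (forall v i, i < K v -> F (i :: v) != 0) ->
  computes n K.
Proof.
move=> [e eF] F0 Fn0; exists (RMu e) => v /=; split.
  by rewrite -(F0 v); exact: eF.
move=> i /Fn0 Fi; exists (F (i :: v)).-1.
by rewrite prednK ?lt0n //; exact: eF.
Qed.

Lemma computes_succ n F : computes n F -> computes n (fun v => (F v).+1).
Proof. by apply: computes_app1; exists RSucc => x. Qed.

Lemma computes_const n c : computes n (fun=> c).
Proof.
elim: c => [|c IHc]; last exact: computes_succ.
have h (i : 'I_0) : recfun n by case: i.
by exists (RComp RZero h) => v; exists [tuple]; split=> // -[].
Qed.

Lemma computable1P (g : nat -> nat) :
  computes 1 (fun v => g (nth 0 v 0)) -> computable1 g.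
Proof. by move=> [e eg]; exists e => x; exact: eg. Qed.

Lemma computable2P (g : nat -> nat -> nat) :
  computes 2 (fun v => g (nth 0 v 0) (nth 0 v 1)) -> computable2 g.
Proof. by move=> [e eg]; exists e => x y; exact: eg. Qed.

Lemma computes_add n F G :
  computes n F -> computes n G -> computes n (fun v => F v + G v).
Proof.
move=> cF cG; apply: (@computes_prec n F (fun w => (nth 0 w 1).+1) G
  (fun i v => F v + i)) => // [|v|i v]; last exact: addnS.
  exact/computes_succ/computes_nth.
exact: addn0.
Qed.

Lemma computes_pred n F : computes n F -> computes n (fun v => (F v).-1).
Proof.
move=> cF; apply: (@computes_prec n (fun=> 0) (fun w => nth 0 w 0) F
  (fun i v => i.-1)) => //; [exact: computes_const | exact: computes_nth].
Qed.

Lemma computes_sub n F G :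
  computes n F -> computes n G -> computes n (fun v => F v - G v).
Proof.
move=> cF cG; apply: (@computes_prec n F (fun w => (nth 0 w 1).-1) G
  (fun i v => F v - i)) => // [|v|i v]; last exact: subnS.
  exact/computes_pred/computes_nth.
exact: subn0.
Qed.

Lemma computable_muln : computable2 muln.
Proof.
apply: computable2P; apply: (@computes_prec 2 (fun=> 0)
  (fun w => nth 0 w 3 + nth 0 w 1) (fun v => nth 0 v 0)
  (fun i v => i * nth 0 v 1)) => //.
- exact: computes_nth.
- exact: computes_const.
- by apply: computes_add; exact: computes_nth.
Qed.

Lemma computes_mul n F G :
  computes n F -> computes n G -> computes n (fun v => F v * G v).
Proof. exact: computes_app2 computable_muln. Qed.

Lemma computes_leq n F G :
  computes n F -> computes n G -> computes n (fun v => F v <= G v).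
Proof.
move=> cF cG.
apply: (@eq_computes _ (fun v => 1 - (F v - G v))) => [v|].
  by rewrite /leq; case: (F v - G v).
by apply: computes_sub; [exact: computes_const | exact: computes_sub].
Qed.

Lemma computes_sum n K F :
    computes n K -> computes n.+1 F ->
  computes n (fun v => \sum_(i < K v) F (nat_of_ord i :: v)).
Proof.
move=> cK cF; apply: (@computes_prec n (fun=> 0)
  (fun w => nth 0 w 1 + F (nth 0 w 0 :: drop 2 w)) K
  (fun k v => \sum_(i < k) F (nat_of_ord i :: v))) => //.
- exact: computes_const.
- apply: computes_add; first exact: computes_nth.
  by apply: (@computes_drop 2 n) => //; exact: computes_nth.
- by move=> v; rewrite big_ord0.
- by move=> i v; rewrite big_ord_recr /= drop0.
Qed.

Lemma computes_half n F : computes n F -> computes n (fun v => (F v)./2).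
Proof.
apply: computes_app1; apply: computable1P.
(* The least [y] with [x <= 2 * y + 1] is [x./2]. *)
apply: (@computes_mu 1 (fun w => nth 0 w 1 - (nth 0 w 0 + nth 0 w 0).+1)).
- apply: computes_sub; first exact: computes_nth.
  by apply: computes_succ; apply: computes_add; exact: computes_nth.
- by move=> v /=; have := odd_double_half (nth 0 v 0); lia.
- by move=> v i /=; have := odd_double_half (nth 0 v 0); lia.
Qed.

Lemma computes_odd n F : computes n F -> computes n (fun v => odd (F v)).
Proof.
move=> cF; apply: (@eq_computes _ (fun v => F v - ((F v)./2 + (F v)./2))).
  by move=> v; have := odd_double_half (F v); lia.
by apply: computes_sub => //; apply: computes_add; exact: computes_half.
Qed.

Lemma sqrt_bounds x :
  Nat.sqrt x * Nat.sqrt x <= x < (Nat.sqrt x).+1 * (Nat.sqrt x).+1.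
Proof. by have := PeanoNat.Nat.sqrt_spec x; lia. Qed.

Lemma computes_sqrt n F : computes n F -> computes n (fun v => Nat.sqrt (F v)).
Proof.
apply: computes_app1; apply: computable1P.
(* A failing comparison counts as [0], so the search finds the least [y] with [x < (y + 1) ^ 2]. *)
apply: (@computes_mu 1
  (fun w => (nth 0 w 0).+1 * (nth 0 w 0).+1 <= nth 0 w 1)).
- apply: computes_leq; last exact: computes_nth.
  by apply: computes_mul; apply: computes_succ; exact: computes_nth.
- move=> v /=; have := sqrt_bounds (nth 0 v 0); lia.
- move=> v i /=; have := sqrt_bounds (nth 0 v 0); nia.
Qed.

(** * Approximations with a budget of mind changes *)

Lemma eventually_forall n (P : nat -> nat -> Prop) :
    (forall i, i < n -> exists s0, forall s, s0 <= s -> P i s) ->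
  exists s0, forall i s, i < n -> s0 <= s -> P i s.
Proof.
elim: n => [|n IHn] evP; first by exists 0.
have [s1 Ps1] := IHn (fun i lin => evP i (ltnW lin)).
have [s2 Ps2] := evP n (leqnn _).
exists (maxn s1 s2) => i s; rewrite ltnS leq_eqVlt geq_max.
by case/predU1P=> [->|lin] /andP[le1 le2]; [exact: Ps2 | exact: Ps1].
Qed.

(* At stage [s] the guess is the least [y] such that neither "[P x y z] for all
   [z]" nor "[Q x y z] for no [z]" has been refuted by some [z < s]. *)
Lemma limit_lemma (A : set nat) : Delta02 A ->
  exists2 a : nat -> nat -> bool, computable2 (fun x s => a x s) &
    forall x, exists s0, forall s, s0 <= s -> a x s = (x \in A).
Proof.
move=> [[P [cP AP]] [Q [cQ AQ]]].
pose U x s y := \sum_(z < s) ~~ P x y z.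
pose V x s y := \sum_(z < s) Q x y z.
have sum0P (b : nat -> bool) s :
    (\sum_(z < s) b z == 0) <-> forall z, z < s -> ~~ b z.
  rewrite sum_nat_eq0; split=> [/forallP b0 z lt|b0].
    by have := b0 (Ordinal lt); rewrite /= eqb0.
  by apply/forallP=> z; rewrite /= eqb0 b0.
have UP x y : (forall s, U x s y == 0) <-> forall z, P x y z.
  split=> [U0 z|Pz s].
    by have /(sum0P (fun z => ~~ P x y z))/(_ z (leqnn _)) := U0 z.+1;
      rewrite negbK.
  by apply/(sum0P (fun z => ~~ P x y z)) => z _; rewrite negbK Pz.
have VP x y : (forall s, V x s y == 0) <-> forall z, ~~ Q x y z.
  split=> [V0 z|Qz s].
    by have /(sum0P (Q x y))/(_ z (leqnn _)) := V0 z.+1.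
  by apply/(sum0P (Q x y)) => z _; exact: Qz.
have U_homo x y s t : s <= t -> U x t y == 0 -> U x s y == 0.
  move=> le_st /(sum0P (fun z => ~~ P x y z)) U0.
  by apply/(sum0P (fun z => ~~ P x y z)) => z lt; apply: U0 (leq_trans lt _).
have V_homo x y s t : s <= t -> V x t y == 0 -> V x s y == 0.
  move=> le_st /(sum0P (Q x y)) V0.
  by apply/(sum0P (Q x y)) => z lt; apply: V0 (leq_trans lt _).
(* A member of [A] has a [Sigma02] witness, a nonmember a counterexample to the [Pi02] condition.
   Hence the search for the guess always ends. *)
have limit x : exists y, (forall s, U x s y == 0) \/ (forall s, V x s y == 0).
  have [/AP[y Py]|nAx] := pselect (A x); first by exists y; left; exact/UP.
  have /existsNP[y nQy] : ~ (forall y, exists z, Q x y z) by rewrite -AQ.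
  exists y; right; apply/VP => z; apply/negP => Qz.
  by apply: nQy; exists z.
have some x s : exists y, U x s y * V x s y == 0.
  by have [y [/(_ s)/eqP U0|/(_ s)/eqP V0]] := limit x; exists y;
    rewrite ?U0 ?V0 ?muln0.
pose guess x s := ex_minn (some x s).
exists (fun x s => U x s (guess x s) <= 0).
  apply: computable2P.
  have cU : computes 3 (fun v => U (nth 0 v 1) (nth 0 v 2) (nth 0 v 0)).
    apply: (@computes_sum 3 (fun v => nth 0 v 2)
      (fun w => ~~ P (nth 0 w 2) (nth 0 w 1) (nth 0 w 0))).
      exact: computes_nth.
    apply: (@eq_computes _
      (fun w => 1 - P (nth 0 w 2) (nth 0 w 1) (nth 0 w 0))).
      by move=> w; case: (P _ _ _).
    apply: computes_sub; first exact: computes_const.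
    by apply: (computes_app3 cP); exact: computes_nth.
  have cV : computes 3 (fun v => V (nth 0 v 1) (nth 0 v 2) (nth 0 v 0)).
    apply: (@computes_sum 3 (fun v => nth 0 v 2)
      (fun w => Q (nth 0 w 2) (nth 0 w 1) (nth 0 w 0))).
      exact: computes_nth.
    by apply: (computes_app3 cQ); exact: computes_nth.
  apply: computes_leq; last exact: computes_const.
  apply: (@computes_let 2 (fun v => guess (nth 0 v 0) (nth 0 v 1)) _ _ cU).
  apply: (computes_mu (computes_mul cU cV)) => v /=.
    by rewrite /guess; case: ex_minnP => y /eqP.
  move=> i; rewrite /guess; case: ex_minnP => y _ min_y lt_iy.
  by apply/negP => /min_y; rewrite leqNgt lt_iy.
move=> x; pose lim y := (forall s, U x s y == 0) \/ (forall s, V x s y == 0).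
have exlim : exists y, `[< lim y >].
  by have [y] := limit x; exists y; apply/asboolP.
have [y /asboolP lim_y min_y] := ex_minnP exlim.
(* Below the least [y] with a claim that is never refuted, both claims eventually fail, so the guess
   settles at [y]. *)
have [s0 Us0] : exists s0, forall i s, i < y -> s0 <= s ->
    U x s i * V x s i != 0.
  apply: eventually_forall => i lt_iy.
  have nlim : ~ lim i by move/asboolP/min_y; rewrite leqNgt lt_iy.
  have /existsNP[s1 /negP nU] : ~ forall s, U x s i == 0.
    by move=> ?; apply: nlim; left.
  have /existsNP[s2 /negP nV] : ~ forall s, V x s i == 0.
    by move=> ?; apply: nlim; right.
  exists (maxn s1 s2) => s; rewrite geq_max => /andP[le1 le2].
  by rewrite muln_eq0 negb_or (contra (U_homo _ _ _ _ le1) nU)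
    (contra (V_homo _ _ _ _ le2) nV).
have guessE s : s0 <= s -> guess x s = y.
  move=> le_s; rewrite /guess; case: ex_minnP => i UVi min_i.
  apply/eqP; rewrite eqn_leq min_i.
    by rewrite leqNgt; apply: contraL UVi => lt_iy; exact: Us0.
  by case: lim_y => [/(_ s)/eqP->|/(_ s)/eqP->]; rewrite ?muln0.
(* For [x] in [A] every [V]-claim is false, so the surviving claim at [y] is the [U]-claim; for [x]
   outside [A] every [U]-claim gets refuted. *)
have [Ax|nAx] := pselect (A x).
  exists s0 => s le_s; rewrite (mem_set Ax) guessE // leqn0.
  case: lim_y => [->//|/VP nQ].
  by have [z Qz] := (AQ x).1 Ax y; move: (nQ z); rewrite Qz.
have [s1 U1] : exists s1, U x s1 y != 0.
  apply: contrapT => nU; apply: nAx; apply/AP; exists y; apply/UP => s.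
  by apply/negPn/negP => Us; apply: nU; exists s.
exists (maxn s0 s1) => s; rewrite geq_max => /andP[le0 le1].
rewrite guessE // leqn0 memNset //.
by apply/negbTE; apply: contra U1; exact: U_homo.
Qed.

Lemma nonincreasing_homo (u : nat -> nat) :
  (forall s, u s.+1 <= u s) -> forall s t, s <= t -> u t <= u s.
Proof.
move=> uS s t /subnK<-; elim: (t - s) => // k; exact: leq_trans (uS _).
Qed.

Lemma nonincreasing_eventually_constant (u : nat -> nat) :
    (forall s, u s.+1 <= u s) ->
  exists r s0, forall s, s0 <= s -> u s = r.
Proof.
move=> uS; have exu : exists r, `[< exists s, u s = r >].
  by exists (u 0); apply/asboolP; exists 0.
have [r /asboolP[s0 us0] min_r] := ex_minnP exu; exists r, s0 => s le_s.
apply/eqP; rewrite eqn_leq -{1}us0 nonincreasing_homo //= min_r //.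
by apply/asboolP; exists s.
Qed.

Section Budget.

Variables (f : nat -> nat) (cand : nat -> nat -> nat -> bool).

(* With [b] mind changes left, [x] follows the [b./2]-th candidate.  The current
   value is the parity of the number of changes made, that is of
   [f x + budget x s]. *)
Fixpoint budget x s : nat :=
  if s is t.+1 then
    budget x t - odd (f x + budget x t + cand x (budget x t)./2 t)
  else f x.

Definition parity_approx x s : bool := odd (f x + budget x s).

Lemma budgetS_le x s : budget x s.+1 <= budget x s.
Proof. exact: leq_subr. Qed.

Lemma budget_homo x s t : s <= t -> budget x t <= budget x s.
Proof. exact/nonincreasing_homo/budgetS_le. Qed.

Lemma approx_changes x s :
  parity_approx x s != parity_approx x s.+1 -> budget x s.+1 < budget x s.
Proof.
move=> ne; rewrite ltn_neqAle budgetS_le andbT.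
by apply: contra ne => /eqP eq_b; rewrite /parity_approx eq_b.
Qed.

(** Each change strictly lowers the budget, so [budget x s.+1] maps the stages [s] of change
    injectively into the numbers below [f x]. *)
Lemma card_approx_changes x :
  ([set s | parity_approx x s != parity_approx x s.+1] #<= `I_(f x))%card.
Proof.
have decr s t : parity_approx x t != parity_approx x t.+1 -> s < t ->
    budget x t.+1 < budget x s.+1.
  by move=> /approx_changes ch /(budget_homo x)/(leq_trans ch).
have inj : {in [set s | parity_approx x s != parity_approx x s.+1]%classic &,
    injective (fun s => budget x s.+1)}.
  move=> s t; rewrite !inE => ch_s ch_t eq_b.
  by have [/(decr _ _ ch_t)|/(decr _ _ ch_s)|//] := ltngtP s t;
    rewrite eq_b ltnn.
rewrite -(card_le_eql (inj_card_eq inj)); apply: subset_card_le.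
move=> _ [s ch <-] /=.
exact: leq_trans (approx_changes ch) (budget_homo x (leq0n s)).
Qed.

(** At most [M] units are spent before stage [M], which leaves [N.*2.+2]. The budgets [N.*2.+1] and
    [N.*2] both follow candidate [N], by then constant: one unit buys agreement, and then nothing
    more is spent. *)
Lemma budget_ge N M x :
    (forall s, M <= s -> cand x N s = cand x N M) ->
    M + N.*2.+2 <= f x ->
  forall s, N.*2 <= budget x s.
Proof.
move=> cst le_f.
have early s : f x <= budget x s + s.
  elim: s => [|s IHs]; first by rewrite addn0.
  by move: IHs => /=; case: odd; lia.
have late s : M <= s -> N.*2 < budget x s \/
    budget x s = N.*2 /\ parity_approx x s = cand x N M.
  move/subnK<-; elim: (s - M) => [|k [lt_b|[eq_b ap]]].
  - by left; have := early M; rewrite add0n; lia.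
  - have [big|small] := ltnP N.*2.+1 (budget x (k + M)).
      by left; rewrite addSn /=; case: odd => /=; lia.
    have eq_b : budget x (k + M) = N.*2.+1 by lia.
    have stepE := cst (k + M) (leq_addl _ _).
    rewrite addSn /parity_approx /= eq_b /= uphalf_double stepE.
    case: (cand x N M); rewrite !oddD /= odd_double; case: (odd (f x)) => /=;
      rewrite ?subn0 ?subn1 ?oddD /= ?odd_double;
      by [left; lia | right].
  - right; have stepE := cst (k + M) (leq_addl _ _).
    move: ap; rewrite addSn /parity_approx /= eq_b doubleK stepE => ap.
    by rewrite oddD ap oddb addbb subn0.
move=> s; have [/late[|[]]|lt_sM] := leqP M s; [lia|lia|].
by have := early s; lia.
Qed.

End Budget.

(** * Density of sets defined by a threshold in square blocks *)

Lemma sqrt_block K i : i < K.*2.+1 -> Nat.sqrt (K * K + i) = K.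
Proof. by move=> lt; have := sqrt_bounds (K * K + i); nia. Qed.

Section Density.
Local Open Scope ring_scope.
Local Open Scope classical_set_scope.
Variable R : realType.

(** The count is the minimum of [L] and the ceiling of [y]. *)
Lemma count_lt_le (y : R) L :
  0 <= y -> \sum_(j < L) ((j%:R < y)%R)%:R <= y + 1.
Proof.
move=> y0; elim: L => [|L IHL]; first by rewrite big_ord0 addr_ge0.
rewrite big_ord_recr /=; have [lt_y|_] := ltP L%:R y; last by rewrite addr0.
apply: le_trans (_ : L%:R + 1 <= _); last by rewrite lerD2r ltW.
rewrite lerD2r -[L in leRHS]card_ord -sumr_const.
by apply: ler_sum => j _; case: (_ < _).
Qed.

Lemma count_lt_ge (y : R) L :
  y <= L%:R -> y <= \sum_(j < L) ((j%:R < y)%R)%:R.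
Proof.
move=> yL; have [L' [lt_y le_y le_L]] : exists L',
    [/\ forall j, (j < L')%N -> j%:R < y, y <= L'%:R & (L' <= L)%N].
  elim: L yL => [|L IHL] yL; first by exists 0%N.
  have [/IHL[L' [h1 h2 h3]]|lt_y] := leP y L%:R.
    by exists L'; split=> //; lia.
  exists L.+1; split=> // j; rewrite ltnS => le_j.
  by apply: le_lt_trans lt_y; rewrite ler_nat.
apply: le_trans le_y _.
rewrite -[L in leRHS](subnKC le_L) big_split_ord /= -[leLHS]addr0.
apply: lerD; last exact: sumr_ge0.
rewrite -[L' in leLHS]card_ord -sumr_const.
by apply: ler_sum => j _; rewrite lt_y.
Qed.

Definition card_below (B : set nat) m : nat :=
  \sum_(j < m) (nat_of_ord j \in B).

Lemma card_below_le B m : (card_below B m <= m)%N.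
Proof.
rewrite -[leqRHS]card_ord -sum1_card; apply: leq_sum => j _; exact: leq_b1.
Qed.

Lemma card_belowD B m n : card_below B (m + n) =
  (card_below B m + \sum_(i < n) ((m + i)%N \in B))%N.
Proof. by rewrite /card_below big_split_ord. Qed.

(** [C] may depend on [e], since [C / m] tends to [0]; half of the tolerance is kept for it. *)
Lemma cvg_rho B (alpha : R) :
    (forall e : R, 0 < e -> exists C, forall m,
      `|(card_below B m)%:R - alpha * m%:R| <= C + e * m%:R) ->
  rho R B @ \oo --> alpha.
Proof.
move=> linear; apply/cvgrPdist_le => e e0.
have [C le_C] := linear (e / 2) ltac:(by rewrite divr_gt0).
near=> m.
have m0 : 0 < m%:R :> R by rewrite ltr0n; near: m; exact: nbhs_infty_gt.
have CM : C <= e / 2 * m%:R.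
  rewrite -ler_pdivrMl ?divr_gt0 //; near: m; exact: nbhs_infty_ger.
rewrite distrC -(ler_pM2r m0) -[X in _ * X <= _]gtr0_norm // -normrM mulrBl.
rewrite /rho divfK ?gt_eqF // (le_trans (le_C m)) //; lra.
Unshelve. all: by end_near. Qed.

(* For fixed [x] the condition is monotone in [r x], so from some block on [B]
   is squeezed between the sets obtained with [r] constantly [alpha - e / 2] and
   constantly [alpha + e / 2]; counting block by block gives an error of
   [O(sqrt m)] below [m]. *)
Lemma density_of_threshold (B : set nat) (r : nat -> R) (alpha : R) X :
    (forall x, 0 <= r x <= 1) -> r @ \oo --> alpha ->
    (forall x, (X <= x)%N -> (x \in B) =
      ((x - Nat.sqrt x * Nat.sqrt x)%:R < r x * (Nat.sqrt x).*2.+1%:R)) ->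
  rho R B @ \oo --> alpha.
Proof.
move=> r01 /cvgrPdist_le r_alpha BE; apply: cvg_rho => e e0.
have e20 : 0 < e / 2 by rewrite divr_gt0.
have [X' _ r_near] := r_alpha _ e20.
pose K0 := (maxn X X').
have near_alpha x : (K0 <= x)%N -> alpha - e / 2 <= r x <= alpha + e / 2.
  by rewrite geq_max => /andP[_ /r_near]; rewrite /= distrC ler_distl.
(* The lower threshold must not exceed the block length for [count_lt_ge], and the upper one must be
   nonnegative for [count_lt_le]. *)
have [q1 q2] : alpha - e / 2 <= 1 /\ 0 <= alpha + e / 2.
  by have := near_alpha _ (leqnn K0); have := r01 K0; lra.
have block K : (K0 <= K)%N ->
    (alpha - e / 2) * K.*2.+1%:R <= (\sum_(i < K.*2.+1) (K * K + i \in B))%:R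
      <= (alpha + e / 2) * K.*2.+1%:R + 1.
  move=> le_K; rewrite natr_sum.
  have blockE (i : 'I_K.*2.+1) : (K0 <= K * K + i)%N /\
      (K * K + i)%N \in B = (i%:R < r (K * K + i)%N * K.*2.+1%:R).
    have le_x : (K0 <= K * K + i)%N by nia.
    split=> //; rewrite BE ?sqrt_block ?addKn //.
    by rewrite (leq_trans (leq_maxl _ _) le_x).
  apply/andP; split.
    apply: le_trans (count_lt_ge (L := K.*2.+1) _) _.
      by rewrite ler_piMl.
    apply: ler_sum => i _; have [/near_alpha/andP[le_r _] ->] := blockE i.
    rewrite ler_nat; case: (ltP i%:R (_ * _)) => //= lt_i.
    by rewrite (lt_le_trans lt_i) // ler_wpM2r.
  apply: le_trans (count_lt_le K.*2.+1 _); last by rewrite mulr_ge0.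
  apply: ler_sum => i _; have [/near_alpha/andP[_ le_r] ->] := blockE i.
  rewrite ler_nat; case: (ltP i%:R (r _ * _)) => //= lt_i.
  by rewrite (lt_le_trans lt_i) // ler_wpM2r.
(* The first term pays for the blocks before [K0], the second for the deviation of [r] from [alpha],
   and [K] for a rounding error of at most one per block. *)
have squares K : `|(card_below B (K * K))%:R - alpha * (K * K)%:R|
    <= (1 + `|alpha|) * (K0 * K0)%:R + e / 2 * (K * K)%:R + K%:R.
  elim: K => [|K IHK].
    rewrite /card_below muln0 big_ord0 !mulr0 subrr normr0 !addr0.
    by rewrite mulr_ge0 // addr_ge0.
  have [lt_K|le_K] := ltnP K K0.
    have le1 : (card_below B (K.+1 * K.+1))%:R <= (K0 * K0)%:R :> R.
      by rewrite ler_nat (leq_trans (card_below_le _ _)) // leq_mul.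
    have le2 : (K.+1 * K.+1)%:R <= (K0 * K0)%:R :> R by rewrite ler_nat leq_mul.
    apply: le_trans (ler_normB _ _) _; rewrite normrM !normr_nat.
    have : `|alpha| * (K.+1 * K.+1)%:R <= `|alpha| * (K0 * K0)%:R.
      exact: ler_wpM2l.
    have : 0 <= e / 2 * (K.+1 * K.+1)%:R by rewrite mulr_ge0 // ltW.
    have : 0 <= K.+1%:R :> R by [].
    lra.
  have -> : (K.+1 * K.+1 = K * K + K.*2.+1)%N by lia.
  rewrite card_belowD !natrD -[K.+1]addn1 natrD.
  have := block _ le_K; move: IHK; rewrite !ler_norml; lra.
(* In [3 + 2 * |alpha|], one [K] is the rounding error, and the incomplete block of [i <= 2 * K]
   elements adds [2] and [2 * |alpha|]. Completing a square absorbs this multiple of [K] into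
   [e / 2 * K ^ 2] and a constant. *)
exists ((1 + `|alpha|) * (K0 * K0)%:R
  + (3 + 2 * `|alpha|) ^+ 2 * (2 * e)^-1) => m.
set K := Nat.sqrt m.
have [i mE lt_i] : exists2 i, m = (K * K + i)%N & (i <= K.*2)%N.
  by exists (m - K * K)%N; have := sqrt_bounds m; rewrite -/K; lia.
have count_m : (card_below B (K * K) <= card_below B m
    <= card_below B (K * K) + i)%N.
  rewrite mE card_belowD leq_addr leq_add2l /= -[leqRHS]card_ord -sum1_card.
  by apply: leq_sum => j _; exact: leq_b1.
have [le1 le2] : (card_below B (K * K))%:R <= (card_below B m)%:R :> R /\
    (card_below B m)%:R <= (card_below B (K * K))%:R + i%:R :> R.
  by rewrite -natrD !ler_nat; apply/andP.
have -> : m%:R = (K * K)%:R + i%:R :> R by rewrite mE natrD.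
have le_i' : i%:R <= 2 * K%:R :> R by rewrite -natrM ler_nat mul2n.
set c := 3 + 2 * `|alpha|.
have amgm : c * K%:R <= e / 2 * (K * K)%:R + c ^+ 2 * (2 * e)^-1.
  rewrite -subr_ge0 natrM.
  have -> : e / 2 * (K%:R * K%:R) + c ^+ 2 * (2 * e)^-1 - c * K%:R
      = (e * K%:R - c) ^+ 2 * (2 * e)^-1 by field; rewrite gt_eqF.
  by rewrite mulr_ge0 ?sqr_ge0 // invr_ge0 mulr_ge0 // ltW.
have le_ai : `|alpha * i%:R| <= 2 * `|alpha| * K%:R.
  by rewrite normrM normr_nat [2 * _]mulrC -mulrA ler_wpM2l.
have ei : 0 <= e * i%:R by rewrite mulr_ge0 // ltW.
have := squares K; move: le_ai amgm; rewrite /c !ler_norml mulrDr mulrDl.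
have : 0 <= K%:R :> R by [].
lra.
Qed.
End Density.

(** * Candidates from finite proportions, and their computability *)

Section Candidate.
Variable a : nat -> nat -> bool.

(* For [n > 0] this compares the relative position of [x] in its block with
   the proportion of elements below [n] in the stage [s] approximation. *)
Definition below_ratio x n s : bool :=
  (x - Nat.sqrt x * Nat.sqrt x) * n
    < (\sum_(i < n) a i s) * (Nat.sqrt x).*2.+1.

(** Only [a i s] with [i < n] matters, so [s0] does not depend on [x]. This lets [f x] outgrow it in
    [budget_ge]. *)
Lemma below_ratio_eventually (A : set nat) :
    (forall x, exists s0, forall s, s0 <= s -> a x s = (x \in A)) ->
  forall n, exists s0, forall x s, s0 <= s -> below_ratio x n s =
    ((x - Nat.sqrt x * Nat.sqrt x) * n < card_below A n * (Nat.sqrt x).*2.+1).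
Proof.
move=> aA n; have [s0 as0] := @eventually_forall n
  (fun i s => a i s = (i \in A)) (fun i _ => aA i).
exists s0 => x s le_s; rewrite /below_ratio /card_below.
by under eq_bigr => i _ do rewrite as0 //.
Qed.

Lemma computable_approx (f : nat -> nat) :
    computable1 f -> computable2 (fun x s => a x s) ->
  computable2 (fun x s => parity_approx f below_ratio x s).
Proof.
move=> cf ca; apply: computable2P.
have cnth n i : i < n -> computes n (fun v => nth 0 v i) := @computes_nth n i.
have cbudget :
    computes 2 (fun v => budget f below_ratio (nth 0 v 0) (nth 0 v 1)).
  (* The list [w] holds the stage, the budget so far, and then the arguments, the first of which is
     [x]. *)
  pose H w := nth 0 w 1 - odd (f (nth 0 w 2) + nth 0 w 1
    + below_ratio (nth 0 w 2) (nth 0 w 1)./2 (nth 0 w 0)).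
  apply: (@computes_prec 2 (fun v => f (nth 0 v 0)) H (fun v => nth 0 v 1)
    (fun s v => budget f below_ratio (nth 0 v 0) s)) => //.
  - exact: cnth.
  - by apply: (computes_app1 cf); exact: cnth.
  have csqrt : computes 4 (fun w => Nat.sqrt (nth 0 w 2)).
    by apply: computes_sqrt; exact: cnth.
  have csum : computes 4 (fun w =>
      \sum_(i < (nth 0 w 1)./2) a i (nth 0 w 0)).
    apply: (@computes_sum 4 (fun w => (nth 0 w 1)./2)
      (fun u => a (nth 0 u 0) (nth 0 u 1))).
      by apply: computes_half; exact: cnth.
    by apply: (computes_app2 ca); exact: cnth.
  have chalf : computes 4 (fun w => (nth 0 w 1)./2).
    by apply: computes_half; exact: cnth.
  apply: computes_sub; first exact: cnth.
  apply: computes_odd; apply: computes_add.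
    by apply: computes_add; [apply: (computes_app1 cf) |]; exact: cnth.
  apply: computes_leq.
    apply: computes_succ; apply: computes_mul => //.
    by apply: computes_sub; [exact: cnth | exact: computes_mul].
  apply: computes_mul => //; apply: computes_succ.
  apply: (@eq_computes _
    (fun w => Nat.sqrt (nth 0 w 2) + Nat.sqrt (nth 0 w 2))).
    by move=> w; rewrite addnn.
  exact: computes_add.
apply: computes_odd; apply: computes_add => //.
by apply: (computes_app1 cf); exact: cnth.
Qed.
End Candidate.

Theorem theorem5p1 (R : realType) (f : nat -> nat)
  (f_computable : computable1 f)
  (f_nondecreasing : forall x y : nat, (x <= y)%N -> (f x <= f y)%N)
  (f_unbounded : forall n : nat, exists x : nat, (n < f x)%N)
  (A : set nat) (A_Delta02 : Delta02 A) (A_density : has_density R A) :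
  exists B : set nat,
    [/\ f_ce f B, has_density R B & density R B = density R A].
Proof.
have [a a_computable a_lim] := limit_lemma A_Delta02.
pose b := budget f (below_ratio a).
have [r /(_ _)/cid-/all_sig[s0 b_lim]] := choice (fun x =>
  nonincreasing_eventually_constant (@budgetS_le f (below_ratio a) x)).
pose B := [set x | odd (f x + r x)]%classic.
have inB x : (x \in B) = odd (f x + r x).
  by apply/idP/idP; rewrite inE.
have r_ge N : exists X, forall x, X <= x -> N.*2 <= r x.
  have [M M_lim] := below_ratio_eventually a_lim N.
  have [X lt_X] := f_unbounded (M + N.*2.+2).
  exists X => x le_x; rewrite -(b_lim _ _ (leqnn (s0 x))).
  apply: (@budget_ge f (below_ratio a) N M).
    by move=> s le_s; rewrite !M_lim.
  exact: leq_trans (ltnW lt_X) (f_nondecreasing _ _ le_x).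
have r_infty : ((r x)./2 @[x --> \oo] --> \oo)%classic.
  apply/cvgnyPge => N; have [X X_ge] := r_ge N.
  by exists X => // x /X_ge /= ?; rewrite -(doubleK N) half_leq.
have rho_r : (rho R A (r x)./2 @[x --> \oo] --> density R A)%classic.
  exact: (cvg_comp _ _ r_infty A_density).
(* From [X] on, [r x >= 2]: the proportion has a nonzero denominator, and the budget is not
   exhausted. *)
have [X r_gt0] := r_ge 1.
have rho_B : (rho R B @ \oo --> density R A)%classic.
  apply: (density_of_threshold (X := X) _ rho_r) => [x|x le_x].
    rewrite /rho divr_ge0 ?ler0n //=.
    (* The junk value [0 / 0 = 0] also lies in the unit interval. *)
    case: (r x)./2 => [|n]; first by rewrite invr0 mulr0 ler01.
    by rewrite ler_pdivrMr ?ltr0n // mul1r ler_nat card_below_le.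
  have r2 : 0 < (r x)./2.
    by have := r_gt0 _ le_x; have := odd_double_half (r x); lia.
  have [s1 s1_lim] := below_ratio_eventually a_lim (r x)./2.
  pose s := maxn (s0 x) s1.
  (* At stage [s] both budget and candidate have settled. A positive budget that does not drop means
     that the value agrees with the candidate. *)
  have := b_lim x s.+1 (leqW (leq_maxl _ _)).
  rewrite /= (b_lim x s (leq_maxl _ _)) (s1_lim x s (leq_maxr _ _)) => step.
  rewrite inB; transitivity ((x - Nat.sqrt x * Nat.sqrt x) * (r x)./2
      < card_below A (r x)./2 * (Nat.sqrt x).*2.+1).
    have : ~~ odd (f x + r x + ((x - Nat.sqrt x * Nat.sqrt x) * (r x)./2
      < card_below A (r x)./2 * (Nat.sqrt x).*2.+1)).
      by have := r_gt0 _ le_x; lia.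
    by rewrite oddD oddb; case: odd; case: (_ < _).
  rewrite /rho mulrAC ltr_pdivlMr ?ltr0n //.
  by rewrite -!natrM ltr_nat.
exists B; split.
- exists (parity_approx f (below_ratio a)); split.
    exact: computable_approx.
  move=> x; split.
  - by rewrite /parity_approx /= oddD addbb.
  - apply: cvg_near_cst; exists (s0 x) => // s /= le_s.
    by rewrite inB /parity_approx b_lim.
  - exact: card_approx_changes.
- by apply/cvg_ex; exists (density R A).
- exact: cvg_lim rho_B.
Qed.
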